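(* Let $P$ be any poset. Then: (i) For any $\mathcal I\subset\mathrm{Int}(P)$, the GRI over $\mathcal I$ is a complete invariant on the collection of all $\mathcal I$-decomposable $P$-modules; that is, if $M,N$ are $\mathcal I$-decomposable $P$-modules with $\mathrm{rk}_M^{\mathcal I}=\mathrm{rk}_N^{\mathcal I}$, then $M\cong N$. (ii) The direct sum decomposition of any interval-decomposable $P$-module $M$ can be obtained via Möbius inversion of $\mathrm{rk}_M$ over the subposet $\mathcal I_M:=\{I\in\mathrm{Int}(P): I\in\mathrm{barc}(M)\}\subset\mathrm{Int}(P)$; that is, the Möbius inversion of $\mathrm{rk}_M^{\mathcal I_M}$ over $(\mathcal I_M,\supset)$ exists and its value at each $I\in\mathcal I_M$ is the multiplicity of $I$ in $\mathrm{barc}(M)$.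
   Context: Fix a field $k$; $\mathbf{vec}$ is the category of finite-dimensional $k$-vector spaces. A poset $P$ is regarded as a category (a unique morphism $p\to q$ iff $p\le q$). A $P$-module is a functor $M:P\to\mathbf{vec}$. An interval of $P$ is a nonempty $I\subset P$ that is convex ($p,r\in I$, $p\le q\le r$ imply $q\in I$) and connected (any two elements of $I$ are joined by a finite sequence in $I$ whose consecutive elements are comparable). $\mathrm{Int}(P)$ is the set of intervals of $P$. For an interval $I$, the interval module $k_I$ is $k$ on $I$, $0$ elsewhere, with identity maps between points of $I$ and zero maps otherwise; it is indecomposable. Every $P$-module is a direct sum of indecomposables, unique up to isomorphism and permutation; $\mathrm{barc}(M)$ is the multiset of isomorphism classes of indecomposable summands, and $I\in\mathrm{barc}(M)$ means that the class of $k_I$ belongs to it. $M$ is interval-decomposable if it is a direct sum of interval modules, and $\mathcal I$-decomposable if every indecomposable summand is isomorphic to $k_I$ with $I\in\mathcal I$. For a connected poset $P$ and a $P$-module $M$, $\mathrm{rk}(M)$ is the rank of the canonical map $\varprojlim M\to\varinjlim M$, namely $i_p\circ\pi_p$ for any $p\in P$ ($\pi_p,i_p$ the structure maps). The GRI of $M$ over $\mathcal I\subset\mathrm{Int}(P)$ is $\mathrm{rk}_M^{\mathcal I}:\mathcal I\to\mathbb Z_{\ge0}$, $I\mapsto\mathrm{rk}(M|_I)$. Any $\mathcal I\subset\mathrm{Int}(P)$ is ordered by containment $\supset$ (so $J$ is below $I$ iff $J\supset I$). If $\mathcal I$ is locally finite (for all $J\supset I$ in $\mathcal I$ there are finitely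 many $K\in\mathcal I$ with $J\supset K\supset I$), a function $f$ on $\mathcal I$ is convolvable if for every $I\in\mathcal I$, $f(J)=0$ for all but finitely many $J\in \mathcal I$ with $J\supset I$. The Möbius inversion of a convolvable $g$ over $\mathcal I$ is $g*\mu_{\mathcal I}$, $(g*\mu_{\mathcal I})(I)=\sum_{J\supset I,\,J\in\mathcal I}g(J)\mu_{\mathcal I}(J,I)$ with $\mu_{\mathcal I}$ the Möbius function of $(\mathcal I,\supset)$. ''The Möbius inversion of $\mathrm{rk}_M^{\mathcal I_M}$ exists'' means that $\mathcal I_M$ is locally finite and $\mathrm{rk}_M^{\mathcal I_M}$ is convolvable. *)

(* Defs.v *)
From HB Require Import structures.
From mathcomp Require Import all_boot all_order all_algebra.
From mathcomp Require Import generic_quotient ring_quotient.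
From mathcomp Require Import boolp classical_sets functions cardinality fsbigop.

Set Implicit Arguments.
Unset Strict Implicit.
Unset Printing Implicit Defensive.

Import Order.TTheory GRing.Theory.

Local Open Scope classical_set_scope.
Local Open Scope order_scope.
Local Open Scope ring_scope.
Local Open Scope quotient_scope.
Local Open Scope card_scope.

HB.instance Definition _ d (T : porderType d) (A : pred T) :=
  [SubChoice_isSubPOrder of {x : T | A x} by <: with d].

Section Posets.
Context {d : Order.disp_t} (P : porderType d).

Definition connected_poset : Prop :=
  forall p q : P, exists2 s : seq P, path (fun x y => x >=< y)%O p s & last p s = q.
End Posets.

Section Intervals.
Context {d : Order.disp_t} (P : porderType d).

Definition poset_convex (I : set P) : Prop :=
  forall p q r : P, I p -> I r -> (p <= q)%O -> (q <= r)%O -> I q.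

Definition is_poset_interval (I : set P) : Prop :=
  [/\ I !=set0, poset_convex I & connected_poset (set_type I)].

Record poset_interval := PosetInterval {
  carrier :> set P;
  _ : `[< is_poset_interval carrier >] }.

HB.instance Definition _ := [isSub for carrier].
HB.instance Definition _ := [Choice of poset_interval by <:].

Lemma intervalP (I : poset_interval) : is_poset_interval I.
Proof. exact/asboolP/(valP I). Qed.

(* Reverse containment: J <= I iff J contains I. *)
Definition interval_le (J I : poset_interval) : bool := `[< I `<=` J >].

Lemma interval_le_refl : reflexive interval_le.
Proof. by move=> I; apply/asboolP. Qed.

Lemma interval_le_anti : antisymmetric interval_le.
Proof.
move=> I J /andP[/asboolP JI /asboolP IJ].
by apply/val_inj/seteqP; split.
Qed.

Lemma interval_le_trans : transitive interval_le.
Proof.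
move=> J I K /asboolP JI /asboolP KJ.
by apply/asboolP; apply: subset_trans KJ JI.
Qed.

Fact interval_display : Order.disp_t. Proof. by split; exact: tt. Qed.

HB.instance Definition _ := Order.Le_isPOrder.Build interval_display poset_interval
  interval_le_refl interval_le_anti interval_le_trans.
End Intervals.

Section Modules.
Context (k : fieldType) {d : Order.disp_t} (P : porderType d).

Record pmod := PMod {
  pm_obj :> P -> vectType k;
  pm_map : forall p q : P, (p <= q)%O -> 'Hom(pm_obj p, pm_obj q);
  pm_map_id : forall (p : P) (pp : (p <= p)%O), pm_map pp = \1%VF;
  pm_map_comp : forall (p q r : P)
      (pq : (p <= q)%O) (qr : (q <= r)%O) (pr : (p <= r)%O),
    pm_map pr = (pm_map qr \o pm_map pq)%VF }.

Record pmod_hom (M N : pmod) := PModHom {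
  ph_fun :> forall p : P, 'Hom(M p, N p);
  ph_nat : forall (p q : P) (pq : (p <= q)%O),
    (pm_map N pq \o ph_fun p = ph_fun q \o pm_map M pq)%VF }.

Definition isomorphic (M N : pmod) : Prop :=
  exists (f : pmod_hom M N) (g : pmod_hom N M), forall p : P,
    (g p \o f p = \1)%VF /\ (f p \o g p = \1)%VF.

(* The canonical map from the (pointwise) direct sum of the N a to M is
   bijective at every point of P; direct sums of P-modules are pointwise. *)
Definition is_direct_sum (M : pmod) (A : choiceType) (N : A -> pmod)
    (inj : forall a, pmod_hom (N a) M) : Prop :=
  forall (p : P) (x : M p), exists! y : (forall a, N a p),
    finite_set [set a | y a != 0] /\ x = \sum_(a \in [set: A]) inj a p (y a).

Definition is_zero (M : pmod) : Prop := forall (p : P) (x : M p), x = 0.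

Definition indecomposable (M : pmod) : Prop :=
  ~ is_zero M /\
  forall (N : bool -> pmod) (inj : forall b, pmod_hom (N b) M),
    is_direct_sum inj -> is_zero (N true) \/ is_zero (N false).

(* A direct sum decomposition into indecomposables. By the
   Krull-Schmidt-Azumaya theorem all of them give the same multiset of
   isomorphism classes, the barcode of M. *)
Record decomposition (M : pmod) := Decomposition {
  dec_index : choiceType;
  summand :> dec_index -> pmod;
  summand_inj : forall a, pmod_hom (summand a) M;
  summand_sum : is_direct_sum summand_inj;
  summand_indec : forall a, indecomposable (summand a) }.

Definition in_barc (X M : pmod) : Prop :=
  exists (D : decomposition M) (a : dec_index D), isomorphic (D a) X.

(* X has multiplicity n in the barcode of M. *)
Definition barc_mult (X M : pmod) (n : nat) : Prop :=
  inhabited (decomposition M) /\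
  forall D : decomposition M,
    [set a : dec_index D | isomorphic (D a) X] #= `I_n.
End Modules.

Section IntervalModules.
Context (k : fieldType) {d : Order.disp_t} (P : porderType d).
Local Open Scope classical_set_scope.

(* k at the points of I and 0 elsewhere, as row vectors of length 1 or 0; the
   all-ones matrix is the identity if both sides have dimension 1 and it is
   the zero map otherwise. *)
Definition interval_mod_obj (I : poset_interval P) (p : P) : vectType k :=
  'rV[k]_(p \in (I : set P)).

Definition interval_mod_map (I : poset_interval P) (p q : P) (_ : (p <= q)%O) :
    'Hom(interval_mod_obj I p, interval_mod_obj I q) :=
  linfun (mulmxr (const_mx 1 : 'M[k]_(p \in (I : set P), q \in (I : set P)))).

Lemma interval_mod_map_id (I : poset_interval P) (p : P) (pp : (p <= p)%O) :
  interval_mod_map I pp = \1%VF.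
Proof.
apply/lfunP => v; rewrite lfunE id_lfunE /=.
apply/rowP => j; rewrite !mxE.
move: v j; rewrite /interval_mod_obj; case: (p \in _) => v j; last by case: j.
by rewrite big_ord1 !mxE mulr1; congr (v _ _); rewrite ord1 [j]ord1.
Qed.

Lemma interval_mod_map_comp (I : poset_interval P) (p q r : P)
    (pq : (p <= q)%O) (qr : (q <= r)%O) (pr : (p <= r)%O) :
  interval_mod_map I pr = (interval_mod_map I qr \o interval_mod_map I pq)%VF.
Proof.
apply/lfunP => v; rewrite comp_lfunE !lfunE /= -mulmxA; congr (v *m _).
apply/matrixP => i j; rewrite !mxE.
have [_ cvx _] := intervalP I.
have pI : p \in (I : set P) by case: (p \in _) i => // -[].
have rI : r \in (I : set P) by case: (r \in _) j => // -[].
have -> : (q \in (I : set P)) = true.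
  by apply/mem_set; apply: cvx pq qr; exact/set_mem.
by rewrite big_ord1 !mxE mulr1.
Qed.

Definition interval_mod (I : poset_interval P) : pmod k P :=
  PMod (interval_mod_map_id I) (@interval_mod_map_comp I).

Definition interval_decomposable (M : pmod k P) : Prop :=
  exists (A : choiceType) (f : A -> poset_interval P)
    (inj : forall a, pmod_hom (interval_mod (f a)) M), is_direct_sum inj.

Definition decomposable_over (S : set (poset_interval P)) (M : pmod k P) : Prop :=
  exists D : decomposition M, forall a : dec_index D,
    exists2 I : poset_interval P, S I & isomorphic (D a) (interval_mod I).

Definition barc_intervals (M : pmod k P) : set (poset_interval P) :=
  [set I | in_barc (interval_mod I) M].
End IntervalModules.

Section Restriction.
Context (k : fieldType) {d : Order.disp_t} (P : porderType d).
Variables (M : pmod k P) (I : set P).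

Definition restrict : pmod k (set_type I) :=
  @PMod k d (set_type I) (fun p => M (val p))
    (fun p q (pq : (p <= q)%O) => pm_map M (pq : (val p <= val q)%O))
    (fun p pp => pm_map_id M pp)
    (fun p q r pq qr pr => pm_map_comp M pq qr pr).
End Restriction.

Section DependentProduct.
Context (k : fieldType) (T : choiceType) (V : T -> vectType k).

Definition dprod : Type := forall t, V t.
HB.instance Definition _ := gen_eqMixin dprod.
HB.instance Definition _ := gen_choiceMixin dprod.

Definition dprod_zero : dprod := fun=> 0.
Definition dprod_opp (x : dprod) : dprod := fun t => - x t.
Definition dprod_add (x y : dprod) : dprod := fun t => x t + y t.
Definition dprod_scale (c : k) (x : dprod) : dprod := fun t => c *: x t.

Lemma dprod_addA : associative dprod_add.
Proof. by move=> x y z; apply/functional_extensionality_dep => t; apply: addrA. Qed.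
Lemma dprod_addC : commutative dprod_add.
Proof. by move=> x y; apply/functional_extensionality_dep => t; apply: addrC. Qed.
Lemma dprod_add0 : left_id dprod_zero dprod_add.
Proof. by move=> x; apply/functional_extensionality_dep => t; apply: add0r. Qed.
Lemma dprod_addN : left_inverse dprod_zero dprod_opp dprod_add.
Proof. by move=> x; apply/functional_extensionality_dep => t; apply: addNr. Qed.

HB.instance Definition _ := GRing.isZmodule.Build dprod
  dprod_addA dprod_addC dprod_add0 dprod_addN.

Lemma dprod_scaleA a b (x : dprod) :
  dprod_scale a (dprod_scale b x) = dprod_scale (a * b) x.
Proof. by apply/functional_extensionality_dep => t; apply: scalerA. Qed.
Lemma dprod_scale1 : left_id 1 dprod_scale.
Proof. by move=> x; apply/functional_extensionality_dep => t; apply: scale1r. Qed.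
Lemma dprod_scaleDr : right_distributive dprod_scale +%R.
Proof. by move=> a x y; apply/functional_extensionality_dep => t; apply: scalerDr. Qed.
Lemma dprod_scaleDl (x : dprod) : {morph dprod_scale^~ x : a b / a + b}.
Proof. by move=> a b; apply/functional_extensionality_dep => t; apply: scalerDl. Qed.

HB.instance Definition _ := GRing.Zmodule_isLmodule.Build k dprod
  dprod_scaleA dprod_scale1 dprod_scaleDr dprod_scaleDl.

Definition fin_supp : {pred dprod} :=
  fun x => `[< finite_set [set t | x t != 0] >].

Lemma fin_supp_submod : submod_closed fin_supp.
Proof.
split.
  apply/asboolP; rewrite (_ : [set _ | _] = set0); first exact: finite_set0.
  by apply/seteqP; split=> // t /=; rewrite eqxx.
move=> c x y /asboolP fx /asboolP fy; apply/asboolP.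
apply: (@sub_finite_set _ _ ([set t | x t != 0] `|` [set t | y t != 0])); last first.
  by rewrite finite_setU.
move=> t /=; rewrite -[(c *: x + y) t]/(c *: x t + y t) => nz.
have [x0|] := eqVneq (x t) 0; last by left.
by right; move: nz; rewrite x0 scaler0 add0r.
Qed.

HB.instance Definition _ := GRing.isSubmodClosed.Build k dprod fin_supp
  fin_supp_submod.

Record dsum := DSum { dsum_val : dprod; _ : dsum_val \in fin_supp }.
HB.instance Definition _ := [isSub for dsum_val].
HB.instance Definition _ := [Choice of dsum by <:].
HB.instance Definition _ := [SubChoice_isSubLmodule of dsum by <:].

Lemma dsum_in_subproof (t : T) (x : V t) :
  (dfwith (fun=> 0) x : dprod) \in fin_supp.
Proof.
apply/asboolP; apply: (@sub_finite_set _ _ [set t]); last exact: finite_set1.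
move=> s /=; case: dfwithP => [//|s' _]; by rewrite eqxx.
Qed.

Definition dsum_in (t : T) (x : V t) : dsum := DSum (dsum_in_subproof x).
End DependentProduct.

Section LimColim.
Context (k : fieldType) {d : Order.disp_t} (P : porderType d).
Variable M : pmod k P.

Definition compatible : {pred dprod M} :=
  fun s => `[< forall (p q : P) (pq : (p <= q)%O), pm_map M pq (s p) = s q >].

Lemma compatible_submod : submod_closed compatible.
Proof.
split; first by apply/asboolP => p q pq; exact: linear0.
move=> c x y /asboolP cx /asboolP cy; apply/asboolP => p q pq.
by have -> : (c *: x + y) p = c *: x p + y p by []; rewrite linearP /= cx cy.
Qed.

HB.instance Definition _ := GRing.isSubmodClosed.Build k (dprod M) compatible
  compatible_submod.

Record pm_lim := PmLim { lim_val : dprod M; _ : lim_val \in compatible }.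
HB.instance Definition _ := [isSub for lim_val].
HB.instance Definition _ := [Choice of pm_lim by <:].
HB.instance Definition _ := [SubChoice_isSubLmodule of pm_lim by <:].

Definition lim_proj (p : P) (s : pm_lim) : M p := lim_val s p.

(* Membership in the submodule of the direct sum spanned by the differences
   between x and its images under the structure maps of M. *)
Definition colim_rel : {pred dsum M} := fun z =>
  `[< forall S : set (dsum M),
        S 0 -> (forall (c : k) u v, S u -> S v -> S (c *: u + v)) ->
        (forall (p q : P) (pq : (p <= q)%O) (x : M p),
           S (dsum_in x - dsum_in (pm_map M pq x))) ->
        S z >].

Lemma colim_rel_submod : submod_closed colim_rel.
Proof.
split; first by apply/asboolP => S S0 _ _.
move=> c u v /asboolP hu /asboolP hv; apply/asboolP => S S0 Sl Sg.
exact: Sl (hu S S0 Sl Sg) (hv S S0 Sl Sg).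
Qed.

HB.instance Definition _ := GRing.isSubmodClosed.Build k (dsum M) colim_rel
  colim_rel_submod.

Definition pm_colim : Type := Quotient.quot colim_rel.
HB.instance Definition _ := GRing.Zmodule.on pm_colim.

Definition colim_pi (u : dsum M) : pm_colim := \pi_(Quotient.quot colim_rel) u.

Definition colim_scale (c : k) (x : pm_colim) : pm_colim :=
  colim_pi (c *: repr (x : Quotient.quot colim_rel)).

Lemma colim_piE (u v : dsum M) :
  (colim_pi u == colim_pi v) = (u - v \in colim_rel).
Proof. by rewrite /colim_pi -Quotient.equivE; exact: eqmodE. Qed.

Lemma colim_pi_additive : zmod_morphism colim_pi.
Proof. by move=> u v; rewrite /colim_pi raddfB. Qed.

HB.instance Definition _ := GRing.isZmodMorphism.Build (dsum M) pm_colim colim_pi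
  colim_pi_additive.

Lemma colim_pi_scale c u : colim_pi (c *: u) = colim_scale c (colim_pi u).
Proof.
apply/eqP; rewrite colim_piE -scalerBr rpredZ // -colim_piE; apply/eqP.
by rewrite /colim_pi reprK.
Qed.

Lemma colim_piW (x : pm_colim) : exists u, x = colim_pi u.
Proof. by exists (repr (x : Quotient.quot colim_rel)); rewrite /colim_pi reprK. Qed.

Lemma colim_scaleA a b (x : pm_colim) :
  colim_scale a (colim_scale b x) = colim_scale (a * b) x.
Proof. by have [u ->] := colim_piW x; rewrite -!colim_pi_scale scalerA. Qed.
Lemma colim_scale1 : left_id 1 colim_scale.
Proof.
by move=> x; have [u ->] := colim_piW x; rewrite -!colim_pi_scale scale1r.
Qed.
Lemma colim_scaleDr : right_distributive colim_scale +%R.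
Proof.
move=> a x y; have [u ->] := colim_piW x; have [v ->] := colim_piW y.
by rewrite -raddfD -!colim_pi_scale scalerDr raddfD.
Qed.
Lemma colim_scaleDl (x : pm_colim) : {morph colim_scale^~ x : a b / a + b}.
Proof.
move=> a b; have [u ->] := colim_piW x.
by rewrite -!colim_pi_scale scalerDl raddfD.
Qed.

HB.instance Definition _ := GRing.Zmodule_isLmodule.Build k pm_colim
  colim_scaleA colim_scale1 colim_scaleDr colim_scaleDl.

Definition colim_in (p : P) (x : M p) : pm_colim := colim_pi (dsum_in x).

Definition canonical_map (p : P) : pm_lim -> pm_colim :=
  fun s => colim_in (lim_proj p s).

Lemma canonical_map_le (p q : P) : (p <= q)%O ->
  canonical_map p = canonical_map q.
Proof.
move=> pq; apply/funext => s; apply/eqP; rewrite /canonical_map colim_piE.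
apply/asboolP => S _ _ Sg; have /asboolP/(_ p q pq) e := valP s.
by rewrite {2}/lim_proj -[lim_val s q]e; exact: Sg.
Qed.
End LimColim.

Section Rank.
Context {k : fieldType}.

(* The image of f has a basis with n elements; U and V may be
   infinite-dimensional. *)
Definition has_rank (U V : lmodType k) (f : U -> V) (n : nat) : Prop :=
  exists v : 'I_n -> V,
    (forall c : 'I_n -> k, \sum_(i < n) c i *: v i = 0 -> forall i, c i = 0) /\
    range f = [set y | exists c : 'I_n -> k, y = \sum_(i < n) c i *: v i].

Context {d : Order.disp_t} {P : porderType d}.

(* If P is connected, canonical_map M p does not depend on p (see
   canonical_map_le), and its rank is finite since it factors through M p. *)
Definition rk (M : pmod k P) : nat :=
  xget 0%N [set n | exists p : P, has_rank (canonical_map (M := M) p) n].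
End Rank.

Definition gri (k : fieldType) d (P : porderType d) (S : set (poset_interval P))
    (M : pmod k P) : set_type S -> nat :=
  fun I => rk (restrict M (val I)).

Section Moebius.
Context {d : Order.disp_t} (T : porderType d).

Definition locally_finite : Prop :=
  forall x y : T, finite_set [set z | (x <= z)%O && (z <= y)%O].

Definition convolvable (f : T -> int) : Prop :=
  forall y : T, finite_set [set x | (x <= y)%O /\ f x != 0].

(* mu is supported on the order relation and is inverse to the zeta function;
   on a locally finite poset there is exactly one such mu. *)
Definition is_moebius (mu : T -> T -> int) : Prop :=
  (forall x y : T, ~~ (x <= y)%O -> mu x y = 0) /\
  (forall x y : T,
     \sum_(z \in [set z | (x <= z)%O && (z <= y)%O]) mu x z = (x == y)%:R).

Definition moebius : T -> T -> int := xget (fun _ _ => 0) is_moebius.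

Definition moebius_inversion (g : T -> int) : T -> int :=
  fun y => \sum_(x \in [set x | (x <= y)%O]) g x * moebius x y.
End Moebius.

(* Main.v *)
(* If M is the direct sum of interval modules k_{f a}, then rk(M|_I) is the
   number of a with I contained in f a: the section 1 of such a summand maps to
   a nonzero class of the colimit, detected by the coordinate along a, while a
   section of any other summand vanishes at some point of I, hence has zero
   image by connectedness. This number is finite because M is pointwise
   finite-dimensional, so the intervals involved form a poset with finite lower
   sets under reverse containment. Hence the GRI is the zeta transform of the
   multiplicity function, and Moebius inversion recovers the latter.

   Only the multiplicity of k_I has to be shown independent of the
   decomposition. As End(k_I) = k and a nonzero endomorphism of k_I factors
   through no indecomposable other than k_I, it is the rank of the composition
   pairing Hom(k_I, M) x Hom(M, k_I) -> k. *)
From HB Require Import structures.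
Require Import Defs.
From mathcomp Require Import all_boot all_order all_algebra.
From mathcomp Require Import finmap.
From mathcomp Require Import boolp classical_sets functions cardinality fsbigop.

Set Implicit Arguments.
Unset Strict Implicit.
Unset Printing Implicit Defensive.

Import Order.TTheory GRing.Theory.

Local Open Scope classical_set_scope.
Local Open Scope ring_scope.
Local Open Scope card_scope.

(** * Dependent choice and finitely supported sums *)

Lemma dep_choice (A : Type) (T : A -> Type) (Q : forall a, T a -> Prop) :
  (forall a, exists t, Q a t) -> exists f : forall a, T a, forall a, Q a (f a).
Proof. by move=> exQ; exists (fun a => projT1 (cid (exQ a))) => a; case: cid. Qed.

Lemma fsum_fset (V : nmodType) (A : choiceType) (B : set A) (F : A -> V) :
  finite_set B -> (forall a, ~ B a -> F a = 0) ->
  \sum_(a \in [set: A]) F a = \sum_(a <- fset_set B) F a.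
Proof.
move=> Bfin F0; apply: fsbigTE => a.
by rewrite in_fset_set// notin_setE => /F0.
Qed.

Lemma raddf_fsum (U V : nmodType) (h : {additive U -> V}) (A : choiceType)
    (B : set A) (F : A -> U) :
  finite_set B -> (forall a, ~ B a -> F a = 0) ->
  h (\sum_(a \in [set: A]) F a) = \sum_(a \in [set: A]) h (F a).
Proof.
move=> Bfin F0; rewrite (fsum_fset Bfin F0) raddf_sum.
by rewrite (fsum_fset Bfin)// => a /F0 ->; rewrite raddf0.
Qed.

Lemma fsum_linear (k : fieldType) (V : lmodType k) (A : choiceType) (B : set A)
    (F G : A -> V) (c : k) : finite_set B ->
    (forall a, ~ B a -> F a = 0) -> (forall a, ~ B a -> G a = 0) ->
  \sum_(a \in [set: A]) (c *: F a + G a) =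
  c *: \sum_(a \in [set: A]) F a + \sum_(a \in [set: A]) G a.
Proof.
move=> Bfin F0 G0; rewrite (fsum_fset Bfin F0) (fsum_fset Bfin G0).
rewrite (fsum_fset Bfin) ?big_split ?scaler_sumr// => a nB.
by rewrite F0// G0// scaler0 addr0.
Qed.

Lemma fsum_single (V : nmodType) (A : choiceType) (a : A) (F : A -> V) :
  (forall b, b != a -> F b = 0) -> \sum_(b \in [set: A]) F b = F a.
Proof.
move=> F0; rewrite -[RHS](@fsbig_set1 _ _ +%R); apply/esym/fsbig_widen => //.
by move=> b [_ /= /eqP]; exact: F0.
Qed.

Lemma fsum_bool (V : nmodType) (F : bool -> V) :
  \sum_(b \in [set: bool]) F b = F true + F false.
Proof.
rewrite (_ : [set: bool] = [set` [:: true; false]]).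
  by rewrite -fsbig_seq// unlock /= addr0.
by apply/seteqP; split=> // -[].
Qed.

(** * Homomorphisms and isomorphisms of modules, elementwise *)

Section ModuleHoms.
Context (k : fieldType) (d : Order.disp_t) (P : porderType d).
Implicit Types M N L X Y : pmod k P.

Lemma ph_natE M N (f : pmod_hom M N) (p q : P) (pq : (p <= q)%O) (x : M p) :
  pm_map N pq (f p x) = f q (pm_map M pq x).
Proof. by have /lfunP/(_ x) := ph_nat f pq; rewrite !comp_lfunE. Qed.

Lemma linear_hom M N (f : forall p, M p -> N p) :
  (forall p c x y, f p (c *: x + y) = c *: f p x + f p y) ->
  (forall p q (pq : (p <= q)%O) x, pm_map N pq (f p x) = f q (pm_map M pq x)) ->
  exists g : pmod_hom M N, forall p x, g p x = f p x.
Proof.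
move=> flin fnat.
pose lin p := GRing.isLinear.Build k (M p) (N p) *:%R (f p) (flin p).
pose F p : {linear M p -> N p} := HB.pack (f p) (lin p).
have gE p x : linfun (F p) x = f p x by rewrite lfunE.
unshelve eexists (@PModHom _ _ _ _ _ (fun p => linfun (F p)) _) => [p q pq|//].
by apply/lfunP => x; rewrite !comp_lfunE !gE fnat.
Qed.

Definition comp_hom M N L (g : pmod_hom N L) (f : pmod_hom M N) : pmod_hom M L.
Proof.
refine (@PModHom _ _ _ _ _ (fun p => (g p \o f p)%VF) _) => p q pq.
by apply/lfunP => x; rewrite !comp_lfunE !ph_natE.
Defined.

Lemma comp_homE M N L (g : pmod_hom N L) (f : pmod_hom M N) p x :
  comp_hom g f p x = g p (f p x).
Proof. by rewrite /= comp_lfunE. Qed.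

Lemma isomorphicP M N : isomorphic M N <->
  exists (f : pmod_hom M N) (g : pmod_hom N M),
    (forall p x, g p (f p x) = x) /\ (forall p x, f p (g p x) = x).
Proof.
split=> [[f [g fg]]|[f [g [fK gK]]]]; exists f, g.
  split=> p x; have [gf fg'] := fg p; rewrite -comp_lfunE ?gf ?fg' id_lfunE//.
by move=> p; split; apply/lfunP => x; rewrite comp_lfunE id_lfunE.
Qed.

Lemma isomorphic_refl M : isomorphic M M.
Proof.
apply/isomorphicP; have [|//|f fE] := @linear_hom M M (fun p x => x); first by [].
by exists f, f; split=> p x; rewrite !fE.
Qed.

Lemma isomorphic_sym M N : isomorphic M N -> isomorphic N M.
Proof. by move=> [f [g fg]]; exists g, f => p; have [] := fg p. Qed.

End ModuleHoms.

(** * Direct sums presented by injections and projections *)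

Section Biproducts.
Context (k : fieldType) (d : Order.disp_t) (P : porderType d).
Implicit Types M X Y : pmod k P.

(** The index type may be infinite: [bi_fin] makes the sum in [bi_sum] finite at each vector. The
    projections, implicit in [is_direct_sum], are available here as module homomorphisms. *)
Record biproduct M (A : choiceType) (N : A -> pmod k P) := Biproduct {
  bi_in : forall a, pmod_hom (N a) M;
  bi_pr : forall a, pmod_hom M (N a);
  bi_prK : forall a p x, bi_pr a p (bi_in a p x) = x;
  bi_pr0 : forall a b p x, a != b -> bi_pr a p (bi_in b p x) = 0;
  bi_fin : forall p x, finite_set [set a | bi_pr a p x != 0];
  bi_sum : forall p x, x = \sum_(a \in [set: A]) bi_in a p (bi_pr a p x) }.

Lemma biproduct_direct_sum M (A : choiceType) (N : A -> pmod k P)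
    (D : biproduct M N) :
  is_direct_sum (bi_in D).
Proof.
move=> p x; exists (fun a => bi_pr D a p x); split.
  by split; [exact: bi_fin|exact: bi_sum].
move=> y [yfin ->]; apply: functional_extensionality_dep => a.
rewrite (raddf_fsum _ yfin) => [|b /negP/negPn/eqP ->]; last by rewrite linear0.
rewrite (@fsum_single _ _ a) /= ?bi_prK// => b ba.
by rewrite bi_pr0 // eq_sym.
Qed.

(** Uniqueness of the coefficients of a vector forces them to be linear and natural in it; they are
    then the projections. *)
Lemma direct_sum_biproduct M (A : choiceType) (N : A -> pmod k P)
    (inj : forall a, pmod_hom (N a) M) : is_direct_sum inj ->
  exists D : biproduct M N, bi_in D = inj.
Proof.
move=> ds; pose y p x := projT1 (cid (ds p x)).
have yfin p x : finite_set [set a | y p x a != 0].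
  by rewrite /y; case: cid => /= z [[]].
have ysum p x : x = \sum_(a \in [set: A]) inj a p (y p x a).
  by rewrite /y; case: cid => /= z [[]].
have yuniq p x z : finite_set [set a | z a != 0] ->
    x = \sum_(a \in [set: A]) inj a p (z a) -> y p x = z.
  by move=> zfin xE; rewrite /y; case: cid => /= t [_]; apply.
have ylin a p c x x' : y p (c *: x + x') a = c *: y p x a + y p x' a.
  pose B := [set a | y p x a != 0] `|` [set a | y p x' a != 0].
  have Bfin : finite_set B by rewrite finite_setU; split; exact: yfin.
  have Bx b : ~ B b -> y p x b = 0.
    by move=> nB; apply: contra_notP nB => /eqP; left.
  have Bx' b : ~ B b -> y p x' b = 0.
    by move=> nB; apply: contra_notP nB => /eqP; right.
  rewrite (yuniq _ _ (fun a => c *: y p x a + y p x' a))//.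
    apply: sub_finite_set Bfin => b /= nz; apply: contrapT => nB.
    by move: nz; rewrite Bx// Bx'// scaler0 addr0 eqxx.
  under eq_fsbigr do rewrite linearP.
  rewrite (fsum_linear _ Bfin) -?ysum// => b nB; last by rewrite Bx'// linear0.
  by rewrite Bx// linear0.
have ynat p q (pq : (p <= q)%O) a x :
    pm_map (N a) pq (y p x a) = y q (pm_map M pq x) a.
  rewrite (yuniq _ _ (fun a => pm_map (N a) pq (y p x a)))//.
    apply: sub_finite_set (yfin p x) => b /=; apply: contra_neq => ->.
    by rewrite linear0.
  rewrite [in LHS](ysum p x) (raddf_fsum _ (yfin p x)) => [|b]; last first.
    by move=> /negP/negPn/eqP ->; rewrite linear0.
  by apply: eq_fsbigr => b _ /=; rewrite ph_natE.
have yin p a x : y p (inj a p x) = dfwith (fun b => 0 : N b p) x.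
  apply: yuniq; last first.
    rewrite (@fsum_single _ _ a) ?dfwith_in// => b ba.
    by rewrite dfwith_out ?linear0// eq_sym.
  apply: (sub_finite_set _ (finite_set1 a)) => b /=.
  by case: dfwithP => // b' _; rewrite eqxx.
have prP : forall a,
    exists g : pmod_hom M (N a), forall p x, g p x = y p x a.
  by move=> a; apply: linear_hom => [p c x x'|p q pq x]; [exact: ylin|exact: ynat].
have [pr prE] := dep_choice prP.
unshelve eexists (@Biproduct _ _ _ inj pr _ _ _ _) => //.
- by move=> a p x; rewrite prE yin dfwith_in.
- by move=> a b p x ab; rewrite prE yin dfwith_out// eq_sym.
- by move=> p x; under eq_set do rewrite prE; exact: yfin.
- by move=> p x; under eq_fsbigr do rewrite prE; exact: ysum.
Qed.

Lemma biproduct_ext M (A : choiceType) (N : A -> pmod k P) (D : biproduct M N)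
    p (x y : M p) :
  (forall a, bi_pr D a p x = bi_pr D a p y) -> x = y.
Proof.
move=> xy; rewrite (bi_sum D x) [RHS](bi_sum D y).
by apply: eq_fsbigr => a _; rewrite xy.
Qed.

(** Each vector is projected from the first module and injected into the second, summand by
    summand. *)
Lemma biproduct_hom M M' (A : choiceType) (N : A -> pmod k P)
    (D : biproduct M N) (D' : biproduct M' N) :
  exists f : pmod_hom M M', forall a p x, bi_pr D' a p (f p x) = bi_pr D a p x.
Proof.
have D0 p (x : M p) a : ~ [set a | bi_pr D a p x != 0] a ->
    bi_in D' a p (bi_pr D a p x) = 0.
  by move=> /negP/negPn/eqP ->; rewrite linear0.
have [|p q pq x|f fE] := @linear_hom _ _ _ M M'
  (fun p x => \sum_(a \in [set: A]) bi_in D' a p (bi_pr D a p x)).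
- move=> p c x y; under eq_fsbigr do rewrite !linearP.
  have fin : finite_set ([set a | bi_pr D a p x != 0] `|`
      [set a | bi_pr D a p y != 0]).
    by rewrite finite_setU; split; exact: bi_fin.
  apply: (fsum_linear _ fin).
    by move=> a nB; apply: D0 => xa; apply: nB; left.
  by move=> a nB; apply: D0 => ya; apply: nB; right.
- rewrite (raddf_fsum _ (bi_fin D x)) => [|a]; last exact: D0.
  by apply: eq_fsbigr => a _ /=; rewrite !ph_natE.
exists f => a p x; rewrite fE (raddf_fsum _ (bi_fin D x)) => [|b]; last exact: D0.
rewrite (@fsum_single _ _ a) /= ?bi_prK// => b ba.
by rewrite bi_pr0// eq_sym.
Qed.

Lemma biproduct_isomorphic M M' (A : choiceType) (N : A -> pmod k P) :
  biproduct M N -> biproduct M' N -> isomorphic M M'.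
Proof.
move=> D D'; apply/isomorphicP.
have [f fE] := biproduct_hom D D'; have [g gE] := biproduct_hom D' D.
by exists f, g; split=> p x; [apply: (biproduct_ext (D := D))
  |apply: (biproduct_ext (D := D'))] => a; rewrite !(gE, fE).
Qed.

Lemma biproduct_reindex M (A B : choiceType) (N : A -> pmod k P) (s : B -> A) :
  bijective s -> biproduct M N -> inhabited (biproduct M (fun b => N (s b))).
Proof.
move=> sbij D; have sinj := bij_inj sbij.
split; apply: (@Biproduct _ _ _ (fun b => bi_in D (s b)) (fun b => bi_pr D (s b))).
- by move=> b p x; exact: bi_prK.
- by move=> a b p x ab; apply: bi_pr0; rewrite (inj_eq sinj).
- move=> p x; have [t st ts] := sbij.
  apply: sub_finite_set (finite_image t (bi_fin D x)) => b /= nz.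
  by exists (s b).
- by move=> p x; rewrite {1}(bi_sum D x) (reindex_fsbigT s).
Qed.

Lemma biproduct_isomorphic_summands M (A : choiceType) (N N' : A -> pmod k P) :
  (forall a, isomorphic (N a) (N' a)) -> biproduct M N ->
  inhabited (biproduct M N').
Proof.
move=> /(_ _)/isomorphicP NN' D.
have [f fP] := dep_choice NN'; have [g fgK] := dep_choice fP.
have fK a p x : g a p (f a p x) = x by have [->] := fgK a.
have gK a p x : f a p (g a p x) = x by have [_ ->] := fgK a.
split; apply: (@Biproduct _ _ _ (fun a => comp_hom (bi_in D a) (g a))
  (fun a => comp_hom (f a) (bi_pr D a))).
- by move=> a p x; rewrite !comp_homE bi_prK.
- by move=> a b p x ab; rewrite !comp_homE bi_pr0// linear0.
- move=> p x; apply: sub_finite_set (bi_fin D x) => a /=; apply: contra_neq.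
  by rewrite comp_homE => ->; rewrite linear0.
- move=> p x; rewrite {1}(bi_sum D x); apply: eq_fsbigr => a _.
  by rewrite !comp_homE fK.
Qed.

(** Nonzero vectors taken from distinct summands are linearly independent in the finite-dimensional
    space [M p]. *)
Lemma biproduct_locally_finite M (A : choiceType) (N : A -> pmod k P) p :
  biproduct M N -> finite_set [set a | exists x : N a p, x != 0].
Proof.
move=> D; apply: contrapT => /(infinite_set_fset (\dim {:M p}).+1)[X XN].
rewrite leqNgt => /negP; apply.
have [x xP] : exists x : forall a, N a p,
    forall a, (exists x : N a p, x != 0) -> x a != 0.
  apply: (dep_choice (T := fun a => N a p)
    (Q := fun a x => (exists x : N a p, x != 0) -> x != 0)) => a.
  by case: (pselect (exists x : N a p, x != 0)) => [[x]|?]; [exists x|exists 0].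
pose e := in_tuple (enum_fset X); pose u a := bi_in D a p (x a).
rewrite ltnS -(size_tuple e) -(size_map u).
suff : free (map_tuple u e) by move=> /eqP <-; exact/dimvS/subvf.
apply/freeP => c c0 i.
have ui (j : 'I_#|` X|) : (map_tuple u e)`_j = u (tnth e j).
  by rewrite -tnth_nth tnth_map.
have /(congr1 (bi_pr D (tnth e i) p)) := c0.
rewrite linear0 linear_sum (bigD1 i)//= ui big1 ?addr0 => [|j ji]; last first.
  rewrite ui linearZ /= bi_pr0 ?scaler0// (tnth_nth (tnth e i)).
  rewrite [X in _ != X](tnth_nth (tnth e i)) nth_uniq ?fset_uniq//.
  by rewrite eq_sym.
rewrite linearZ /= bi_prK => /eqP; rewrite scaler_eq0.
have /negPf-> : x (tnth e i) != 0 by apply/xP/XN/mem_tnth.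
by rewrite orbF => /eqP.
Qed.

End Biproducts.

(** * Connectedness, interval modules and their endomorphisms *)

Lemma connected_ind (d : Order.disp_t) (T : porderType d) (Q : T -> Prop) :
  connected_poset T -> (forall p q, (p <= q)%O -> Q p <-> Q q) ->
  forall p q, Q p -> Q q.
Proof.
move=> Tconn Qle p q; have [s] := Tconn p q.
elim: s p => [p _ <- //|r s IHs p /= /andP[pr rs] rq Qp].
by apply: (IHs r) => //; move: pr => /orP[] /Qle []; auto.
Qed.

Section IntervalModuleTheory.
Context (k : fieldType) (d : Order.disp_t) (P : porderType d).
Implicit Types (I J : poset_interval P) (M X Y : pmod k P).

(** The generator at points of [I]; elsewhere the row has length 0 and this is the zero vector. *)
Definition int_one I p : interval_mod k I p :=
  const_mx 1 : 'rV[k]_(p \in (I : set P)).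

(** The coordinate along [int_one]. Summing over all columns gives a linear form at every point,
    without a case distinction on membership in [I]. *)
Definition int_coef I p (x : interval_mod k I p) : k :=
  \sum_j (x : 'rV[k]_(p \in (I : set P))) 0 j.

Lemma int_coef_linear I p (c : k) (x y : interval_mod k I p) :
  int_coef (c *: x + y) = c * int_coef x + int_coef y.
Proof.
rewrite mulr_sumr -big_split /=; apply: eq_bigr => j _.
by rewrite !mxE.
Qed.

HB.instance Definition _ I p := GRing.isLinear.Build k (interval_mod k I p) k
  *%R (@int_coef I p) (@int_coef_linear I p).

Lemma int_coefK I p (x : interval_mod k I p) : x = int_coef x *: int_one I p.
Proof.
rewrite /int_coef; move: x; rewrite /int_one /= /interval_mod_obj.
case: (p \in _) => x; apply/rowP => j; last by case: j.
by rewrite big_ord1 !mxE mulr1 ord1.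
Qed.

Lemma int_coef_one I p : carrier I p -> int_coef (int_one I p) = 1.
Proof.
move=> /mem_set Ip; rewrite /int_coef /int_one Ip big_ord1 mxE//.
Qed.

Lemma interval_mod_eq0 I p (x : interval_mod k I p) : ~ carrier I p -> x = 0.
Proof.
move=> nI; have nIp := memNset nI; apply/rowP => j; exfalso.
by move: j; rewrite nIp => -[].
Qed.

Lemma int_coef_map I p q (pq : (p <= q)%O) (x : interval_mod k I p) :
  carrier I p -> carrier I q ->
  int_coef (pm_map (interval_mod k I) pq x) = int_coef x.
Proof.
move=> /mem_set Ip /mem_set Iq; rewrite /int_coef /= lfunE /=.
move: x; rewrite /= /interval_mod_obj Ip Iq => x.
by rewrite !big_ord1 !mxE big_ord1 !mxE mulr1.
Qed.

Lemma int_map_one I p q (pq : (p <= q)%O) : carrier I p -> carrier I q ->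
  pm_map (interval_mod k I) pq (int_one I p) = int_one I q.
Proof.
by move=> Ip Iq; rewrite [LHS]int_coefK int_coef_map// int_coef_one// scale1r.
Qed.

(** An endomorphism is a scalar at each point of [I], where the space is a line. Naturality equates
    the scalars at comparable points, and connectedness equates them all. *)
Lemma interval_mod_End I (h : pmod_hom (interval_mod k I) (interval_mod k I)) :
  exists c : k, forall p x, h p x = c *: x.
Proof.
have [[p0 Ip0] _ Iconn] := intervalP I.
exists (int_coef (h p0 (int_one I p0))) => p x.
have [Ip|nIp] := pselect (carrier I p); last first.
  by rewrite [LHS]interval_mod_eq0// [RHS]interval_mod_eq0.
pose Q (q : set_type I) :=
  int_coef (h (val q) (int_one I (val q))) = int_coef (h p0 (int_one I p0)).
have Qle (q r : set_type I) : (q <= r)%O -> Q q <-> Q r.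
  move=> qr; have qr' : (val q <= val r)%O := qr.
  have Iq := set_valP q; have Ir := set_valP r.
  by rewrite /Q -(int_map_one qr')// -ph_natE int_coef_map.
have /(_ (SigSub (mem_set Ip))) :=
  connected_ind Iconn Qle (p := SigSub (mem_set Ip0)) _ erefl.
rewrite /Q /= => hp; rewrite {1}(int_coefK x) linearZ /= (int_coefK (h p _)) hp.
by rewrite scalerA mulrC -scalerA -int_coefK.
Qed.

End IntervalModuleTheory.

(** * Independence of the multiplicity of an interval module from the decomposition *)

Section Multiplicity.
Context (k : fieldType) (d : Order.disp_t) (P : porderType d).
Implicit Types (I J : poset_interval P) (M X Y : pmod k P).

(** The idempotent onto the summand [true] is a scalar [c]. If [c] is 0, this summand vanishes;
    otherwise [c] kills the image of the other summand, which therefore vanishes. *)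
Lemma interval_mod_indecomposable I : indecomposable (interval_mod k I).
Proof.
have [[p0 Ip0] _ _] := intervalP I.
split=> [/(_ p0 (int_one k I p0))|N inj /direct_sum_biproduct[D _]].
  move=> /(congr1 (@int_coef _ _ _ _ _)); rewrite int_coef_one// linear0.
  by move/eqP; rewrite oner_eq0.
have [c hE] := interval_mod_End (comp_hom (bi_in D true) (bi_pr D true)).
have cE p x : bi_in D true p (bi_pr D true p x) = c *: x by rewrite -comp_homE.
have [c0|c0] := eqVneq c 0.
  left=> p x; rewrite -(bi_prK D x) -[in LHS](bi_prK D x) cE c0.
  by rewrite scale0r linear0.
have dE p x : c *: (bi_in D false p x) = 0.
  by rewrite -cE bi_pr0// linear0.
right=> p x; have /eqP := dE p x; rewrite scaler_eq0 (negPf c0) /= => /eqP x0.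
by rewrite -(bi_prK D x) x0 linear0.
Qed.

Section Kernel.
Variables (X Y : pmod k P) (g : pmod_hom Y X).

(** By naturality of [g] the structure maps of [Y] preserve its kernel; [vsproj] only retypes a
    vector already lying there. *)
Definition ker_map (p q : P) (pq : (p <= q)%O) :
    'Hom(subvs_of (lker (g p)), subvs_of (lker (g q))) :=
  linfun (vsproj (lker (g q)) \o pm_map Y pq \o vsval).

Lemma ker_mapE (p q : P) (pq : (p <= q)%O) x :
  vsval (ker_map pq x) = pm_map Y pq (vsval x).
Proof.
rewrite lfunE /= vsprojK// memv_ker -ph_natE.
by have := subvsP x; rewrite memv_ker => /eqP ->; rewrite linear0.
Qed.

Lemma ker_map_id (p : P) (pp : (p <= p)%O) : ker_map pp = \1%VF.
Proof.
apply/lfunP => x; apply: val_inj.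
by rewrite /= ker_mapE pm_map_id !id_lfunE.
Qed.

Lemma ker_map_comp (p q r : P)
    (pq : (p <= q)%O) (qr : (q <= r)%O) (pr : (p <= r)%O) :
  ker_map pr = (ker_map qr \o ker_map pq)%VF.
Proof.
apply/lfunP => x; apply: val_inj; rewrite /= comp_lfunE !ker_mapE.
by rewrite (pm_map_comp Y pq qr pr) comp_lfunE.
Qed.

Definition ker_mod : pmod k P := PMod ker_map_id ker_map_comp.

Lemma ker_mod_in : exists h : pmod_hom ker_mod Y, forall p x, h p x = vsval x.
Proof.
apply: (@linear_hom _ _ _ ker_mod Y (fun p x => vsval x)) => //.
by move=> p q pq x; rewrite -ker_mapE.
Qed.

(** The composite of [g] followed by [f] is idempotent, so [y] splits into [f (g y)] and
    [y - f (g y)], the latter in the kernel of [g]. *)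
Lemma split_biproduct (f : pmod_hom X Y) : (forall p x, g p (f p x) = x) ->
  inhabited (biproduct Y (fun b : bool => if b then X else ker_mod)).
Proof.
move=> gf; have [h hE] := ker_mod_in.
have gh p (x : ker_mod p) : g p (h p x) = 0.
  by rewrite hE; apply/eqP; rewrite -memv_ker; exact: subvsP.
have rker p (y : Y p) : y - f p (g p y) \in lker (g p).
  by rewrite memv_ker linearB /= gf subrr.
have [|p q pq x|r rE] := @linear_hom _ _ _ Y ker_mod
  (fun p y => vsproj (lker (g p)) (y - f p (g p y))).
- move=> p c x y.
  have -> : c *: x + y - f p (g p (c *: x + y)) =
      c *: (x - f p (g p x)) + (y - f p (g p y)).
    by rewrite (linearP (g p)) /= (linearP (f p)) /= scalerBr opprD addrACA.
  by rewrite linearP.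
- apply: val_inj; rewrite /= ker_mapE !vsprojK ?rker//.
  by rewrite linearB /= !ph_natE.
have hr p x : h p (r p x) = x - f p (g p x) by rewrite hE rE vsprojK ?rker.
have rf p x : r p (f p x) = 0 by rewrite rE gf subrr linear0.
have rh p x : r p (h p x) = x.
  by rewrite rE gh linear0 subr0 hE vsvalK.
split; apply: (@Biproduct _ _ _ _ _ _
  (fun b => if b return pmod_hom (if b then X else ker_mod) Y then f else h)
  (fun b => if b return pmod_hom Y (if b then X else ker_mod) then g else r)).
- by case=> p x.
- by case=> -[].
- by move=> p x; exact: finite_finset.
- by move=> p x; rewrite fsum_bool hr addrC subrK.
Qed.

End Kernel.

(** The kernel of the retraction [g] is a complement of [X] in [Y]; as [X] is nonzero,
    indecomposability makes this kernel zero. *)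
Lemma indecomposable_retract X Y (f : pmod_hom X Y) (g : pmod_hom Y X) :
  ~ is_zero X -> indecomposable Y -> (forall p x, g p (f p x) = x) ->
  isomorphic Y X.
Proof.
move=> X0 [_ Yind] gf; have [D] := split_biproduct gf.
case: (Yind _ _ (biproduct_direct_sum D)) => [/X0[]|ker0].
apply/isomorphicP; exists g, f; split=> // p y.
have yker : y - f p (g p y) \in lker (g p).
  by rewrite memv_ker linearB /= gf subrr.
have /(congr1 vsval) := ker0 p (Subvs yker).
by move=> /= /eqP; rewrite subr_eq0 => /eqP/esym.
Qed.

(** The composite is a scalar [c]. If [c] were nonzero, dividing [g] by it would exhibit the
    interval module as a retract of [Y], hence as isomorphic to [Y]. *)
Lemma interval_mod_factor I Y (f : pmod_hom (interval_mod k I) Y)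
    (g : pmod_hom Y (interval_mod k I)) :
  indecomposable Y -> ~ isomorphic Y (interval_mod k I) ->
  forall p x, g p (f p x) = 0.
Proof.
move=> Yind nYI; have [c hE] := interval_mod_End (comp_hom g f).
have cE p x : g p (f p x) = c *: x by rewrite -comp_homE.
move=> p x; rewrite cE; have [->|c0] := eqVneq c 0; first exact: scale0r.
exfalso; apply: nYI.
have [||g' g'E] := @linear_hom _ _ _ Y (interval_mod k I)
    (fun p x => c^-1 *: g p x).
- by move=> q a u v; rewrite linearP scalerDr !scalerA mulrC.
- by move=> q r qr u; rewrite linearZ; congr (_ *: _); exact: ph_natE.
apply: (@indecomposable_retract _ _ f g') => //.
  by have [] := interval_mod_indecomposable I.
by move=> q u; rewrite g'E cE scalerA mulVf// scale1r.
Qed.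

Lemma finite_isomorphic_summands M (A : choiceType) (N : A -> pmod k P) I :
  biproduct M N -> finite_set [set a | isomorphic (N a) (interval_mod k I)].
Proof.
move=> D; have [[p0 Ip0] _ _] := intervalP I.
apply: sub_finite_set (biproduct_locally_finite p0 D) => a /= /isomorphicP.
move=> [f [g [fK gK]]]; exists (g p0 (int_one k I p0)).
apply/eqP => /(congr1 (f p0)); rewrite gK linear0.
move=> /(congr1 (@int_coef _ _ _ _ _)); rewrite int_coef_one// linear0.
by move/eqP; rewrite oner_eq0.
Qed.

(* The maps k_I -> N a -> M -> N' b -> M -> N c -> k_I, for N a, N c, N' b
   isomorphic to k_I, factor an identity matrix through the matrix size of the
   second decomposition, because a map k_I -> N' b -> k_I with N' b not
   isomorphic to k_I vanishes. *)
Lemma card_isomorphic_summands_le M (A A' : choiceType)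
    (N : A -> pmod k P) (N' : A' -> pmod k P) I :
  biproduct M N -> biproduct M N' -> (forall b, indecomposable (N' b)) ->
  (#|` fset_set [set a | isomorphic (N a) (interval_mod k I)]| <=
   #|` fset_set [set b | isomorphic (N' b) (interval_mod k I)]|)%N.
Proof.
move=> D D' N'ind; have [[p0 Ip0] _ _] := intervalP I.
set B := [set a | _]; set B' := [set b | _].
have Bfin : finite_set B := finite_isomorphic_summands I D.
have B'fin : finite_set B' := finite_isomorphic_summands I D'.
pose e := in_tuple (enum_fset (fset_set B)).
pose e' := in_tuple (enum_fset (fset_set B')).
have eB i : isomorphic (N (tnth e i)) (interval_mod k I).
  by have := mem_tnth i e; rewrite in_fset_set// inE.
have e'B j : isomorphic (N' (tnth e' j)) (interval_mod k I).
  by have := mem_tnth j e'; rewrite in_fset_set// inE.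
have {}eB i := (isomorphicP _ _).1 (eB i).
have {}e'B j := (isomorphicP _ _).1 (e'B j).
have [f fP] := dep_choice eB; have [g {fP}gf] := dep_choice fP.
have [f' fP] := dep_choice e'B; have [g' {fP}gf'] := dep_choice fP.
pose one := int_one k I p0.
pose z l := bi_in D (tnth e l) p0 (g l p0 one).
pose X := \matrix_(i, j) int_coef (f i p0 (bi_pr D (tnth e i) p0
   (bi_in D' (tnth e' j) p0 (g' j p0 one)))).
pose Y := \matrix_(j, l) int_coef (f' j p0 (bi_pr D' (tnth e' j) p0 (z l))).
suff XY : X *m Y = 1%:M by exact: (mulmx1_min XY).
apply/matrixP => i l; rewrite !mxE.
pose h b := int_coef (f i p0 (bi_pr D (tnth e i) p0
   (bi_in D' b p0 (bi_pr D' b p0 (z l))))).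
(* A vector of the interval module is its coefficient times [one], so the two matrix entries
   multiply to the coefficient of the route through one summand, where [f'] and [g'] cancel. *)
transitivity (\sum_(j < size e') h (tnth e' j)).
  apply: eq_bigr => j _; rewrite !mxE /h mulrC -linearZ /=; congr int_coef.
  rewrite -!linearZ /= -int_coefK; have [-> //] := gf' j.
rewrite -(big_tnth _ _ _ xpredT h) /= -(@fsum_fset _ _ B')//; last first.
  move=> b nB; rewrite /h /z.
  pose u := comp_hom (bi_pr D' b) (comp_hom (bi_in D (tnth e l)) (g l)).
  pose v := comp_hom (f i) (comp_hom (bi_pr D (tnth e i)) (bi_in D' b)).
  have := interval_mod_factor u v (N'ind b) nB one.
  by rewrite !comp_homE => ->; rewrite linear0.
(* The sum now runs over all summands of the second decomposition, so it reassembles [z l]. *)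
transitivity (int_coef (f i p0 (bi_pr D (tnth e i) p0 (z l)))).
  have h0 b : ~ [set b | bi_pr D' b p0 (z l) != 0] b ->
      bi_in D' b p0 (bi_pr D' b p0 (z l)) = 0.
    by move=> /negP/negPn/eqP ->; rewrite linear0.
  rewrite [in RHS](bi_sum D' (z l)).
  have fin := bi_fin D' (z l).
  by do 3![rewrite (raddf_fsum _ fin) /= => [|b /h0 ->]; rewrite ?linear0//].
rewrite /z; have [->|il] := eqVneq i l.
  by rewrite bi_prK; have [_ ->] := gf l; exact: int_coef_one.
rewrite bi_pr0 ?linear0// (tnth_nth (tnth e i)) [X in _ != X](tnth_nth (tnth e i)).
by rewrite nth_uniq ?fset_uniq.
Qed.

End Multiplicity.

(** * Uniqueness of the rank and linearity of the limit and colimit maps *)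

Section Rank.
Context (k : fieldType) (d : Order.disp_t) (P : porderType d).
Implicit Types (I J : poset_interval P) (M X Y : pmod k P).

(** Each family expands in the other, and by freeness of the first the coefficient matrices multiply
    to the identity of size [n], factored through size [m]. *)
Lemma has_rank_le (U V : lmodType k) (f : U -> V) n m :
  has_rank f n -> has_rank f m -> (n <= m)%N.
Proof.
move=> [v [vfree vE]] [w [_ wE]].
have vw i : exists c : 'I_m -> k, v i = \sum_(j < m) c j *: w j.
  suff : range f (v i) by rewrite wE.
  rewrite vE; exists (fun j => (j == i)%:R).
  rewrite (bigD1 i)//= eqxx scale1r big1 ?addr0// => j /negPf ->.
  exact: scale0r.
have wv j : exists c : 'I_n -> k, w j = \sum_(i < n) c i *: v i.
  suff : range f (w j) by rewrite vE.
  rewrite wE; exists (fun i => (i == j)%:R).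
  rewrite (bigD1 j)//= eqxx scale1r big1 ?addr0// => i /negPf ->.
  exact: scale0r.
have [a aE] := choice vw; have [b bE] := choice wv.
apply: (@mulmx1_min _ _ _ (\matrix_(i, j) a i j) (\matrix_(j, l) b j l)).
apply/matrixP => i l; rewrite !mxE.
suff /(_ l)/eqP : forall l, \sum_(j < m) a i j * b j l - (i == l)%:R = 0.
  by rewrite subr_eq0 => /eqP <-; apply: eq_bigr => j _; rewrite !mxE.
apply: vfree; under eq_bigr => j _ do rewrite scalerBl scaler_suml.
rewrite big_split /= exchange_big /= sumrN.
have -> : \sum_(l < n) (i == l)%:R *: v l = v i.
  rewrite (bigD1 i)//= eqxx scale1r big1 ?addr0// => j.
  by rewrite eq_sym => /negPf ->; rewrite scale0r.
apply/eqP; rewrite subr_eq0 [v i in X in _ == X]aE; apply/eqP/eq_bigr => j _.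
by rewrite bE scaler_sumr; apply: eq_bigr => l' _; rewrite scalerA.
Qed.

Lemma canonical_map_connected d' (T : porderType d') (M : pmod k T) :
  connected_poset T -> forall p q, canonical_map (M := M) p = canonical_map q.
Proof.
move=> Tconn p q; apply: (connected_ind
  (Q := fun q => canonical_map (M := M) p = canonical_map q) Tconn) erefl.
by move=> r s rs; rewrite (canonical_map_le M rs).
Qed.

(** [rk] chooses a point and a rank there. Connectedness removes the dependence on the point, and
    [has_rank_le] in both directions that on the rank. *)
Lemma rkE d' (T : porderType d') (M : pmod k T) (p : T) n :
  connected_poset T -> has_rank (canonical_map (M := M) p) n -> rk M = n.
Proof.
move=> Tconn rkn; rewrite /rk; case: xgetP => [m -> [q rkm]|/(_ n)[]]; last by exists p.
rewrite (canonical_map_connected M Tconn q p) in rkm.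
by apply/eqP; rewrite eqn_leq !(has_rank_le rkm rkn, has_rank_le rkn rkm).
Qed.

Section LinearStructure.
Context (d' : Order.disp_t) (T : porderType d') (M : pmod k T).

Lemma dsum_valE (t : T) c (u v : dsum M) :
  dsum_val (c *: u + v) t = c *: dsum_val u t + dsum_val v t.
Proof. by []. Qed.

Lemma dsum_in_linear (t : T) c (x y : M t) :
  dsum_in (c *: x + y) = c *: dsum_in x + dsum_in y :> dsum M.
Proof.
apply: val_inj; apply: functional_extensionality_dep => s.
rewrite [RHS]dsum_valE /=; case: dfwithP => [|s' ts].
  by rewrite !dfwith_in.
by rewrite !dfwith_out// scaler0 addr0.
Qed.

Lemma colim_in_linear (t : T) c (x y : M t) :
  colim_in (c *: x + y) = c *: colim_in x + colim_in y :> pm_colim M.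
Proof.
rewrite /colim_in dsum_in_linear raddfD; congr (_ + _).
exact: colim_pi_scale.
Qed.

HB.instance Definition _ t := GRing.isLinear.Build k (M t) (pm_colim M) *:%R
  (@colim_in _ _ _ M t) (@colim_in_linear t).

Lemma lim_proj_linear (t : T) c (x y : pm_lim M) :
  lim_proj t (c *: x + y) = c *: lim_proj t x + lim_proj t y.
Proof. by []. Qed.

HB.instance Definition _ t := GRing.isLinear.Build k (pm_lim M) (M t) *:%R
  (@lim_proj _ _ _ M t) (@lim_proj_linear t).

End LinearStructure.

(** * The generalized rank of a direct sum of interval modules *)

Section IntervalRank.
Variables (M : pmod k P) (A : choiceType) (f : A -> poset_interval P).
Variables (D : biproduct M (fun a => interval_mod k (f a))) (I : poset_interval P).
Let R := Defs.restrict M (carrier I).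
Let B := [set a | carrier I `<=` carrier (f a)].

(** All these summands are nonzero at one fixed point of [I]. *)
Lemma finite_intervals_above : finite_set B.
Proof.
have [[p0 Ip0] _ _] := intervalP I.
apply: sub_finite_set (biproduct_locally_finite p0 D) => a /(_ _ Ip0) fp0.
exists (int_one k (f a) p0); apply/eqP => /(congr1 (@int_coef _ _ _ _ _)).
by rewrite int_coef_one// linear0 => /eqP; rewrite oner_eq0.
Qed.
Let Bfin := finite_intervals_above.

Lemma one_compatible a : B a ->
  (fun q => bi_in D a (val q) (int_one k (f a) (val q))) \in compatible (M := R).
Proof.
move=> Ba; apply/asboolP => p q pq.
apply: (etrans (ph_natE (bi_in D a) (pq : (val p <= val q)%O) _)).
by rewrite int_map_one//; apply: Ba; exact: set_valP.
Qed.

Lemma component_compatible (s : pm_lim R) a :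
  (fun q => bi_in D a (val q) (bi_pr D a (val q) (lim_proj q s)))
  \in compatible (M := R).
Proof.
apply/asboolP => p q pq; pose pq' : (val p <= val q)%O := pq.
apply: (etrans (ph_natE (bi_in D a) pq' (bi_pr D a (val p) (lim_proj p s)))).
rewrite (ph_natE (bi_pr D a) pq'); congr (bi_in D a (val q) _).
congr (bi_pr D a (val q) _).
by have /asboolP/(_ p q pq) := valP s.
Qed.

(* A section of k_{f a} on I can be evaluated at any point of I, and vanishes
   at a point of I outside f a. *)
Lemma component_eq0 (s : pm_lim R) a (p : set_type (carrier I)) : ~ B a ->
  colim_in (bi_in D a (val p) (bi_pr D a (val p) (lim_proj p s)) : R p) = 0.
Proof.
have [_ _ Iconn] := intervalP I.
move=> /existsNP[q /not_implyP[Iq nfq]].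
pose t := PmLim (component_compatible s a).
pose q' : set_type (carrier I) := SigSub (mem_set Iq).
rewrite -[LHS]/(canonical_map p t) (canonical_map_connected R Iconn p q').
rewrite /canonical_map [lim_proj _ _](_ : _ = 0) ?linear0//.
rewrite /lim_proj /=.
rewrite (interval_mod_eq0 (bi_pr D a q (lim_val s q')) nfq).
exact: linear0.
Qed.

(** The linear functional that detects the summand [a] in the colimit: it adds up the coordinates
    along [a] over all points of [I]. *)
Definition coord_sum a (z : dsum R) : k :=
  \sum_(q \in [set: set_type (carrier I)])
    int_coef (bi_pr D a (val q) (dsum_val z q)).

Lemma coord_sum_linear a c u v :
  coord_sum a (c *: u + v) = c * coord_sum a u + coord_sum a v.
Proof.
have fin (z : dsum R) : finite_set [set q | dsum_val z q != 0].
  by have /asboolP := valP z.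
have Ufin : finite_set ([set q | dsum_val u q != 0] `|`
    [set q | dsum_val v q != 0]).
  by rewrite finite_setU.
rewrite /coord_sum -[c * _]/(c *: (_ : k^o)) -(fsum_linear (V := k^o) _ Ufin).
- by apply: eq_fsbigr => q _; rewrite dsum_valE !linearP.
- move=> q nU; suff -> : dsum_val u q = 0 by rewrite !linear0.
  by apply: contra_notP nU => /eqP; left.
- move=> q nU; suff -> : dsum_val v q = 0 by rewrite !linear0.
  by apply: contra_notP nU => /eqP; right.
Qed.

Lemma coord_sum_in a (p : set_type (carrier I)) (x : R p) :
  coord_sum a (dsum_in x) = int_coef (bi_pr D a (val p) x).
Proof.
rewrite /coord_sum (@fsum_single _ _ p) /= ?dfwith_in// => q qp.
by rewrite dfwith_out ?linear0// eq_sym.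
Qed.

(** When [I] lies in [f a], structure maps between points of [I] preserve the coordinate along [a].
    The zeros of [coord_sum a] thus form a submodule containing the generators of [colim_rel]. *)
Lemma coord_sum_colim a (p : set_type (carrier I)) (x : R p) : B a ->
  colim_in x = 0 -> int_coef (bi_pr D a (val p) x) = 0.
Proof.
move=> Ba; rewrite -(linear0 (@colim_in _ _ _ R p)) => /eqP.
rewrite /colim_in colim_piE => /asboolP/(_ [set z | coord_sum a z = 0]) /= H.
have N0 (u v : dsum R) : coord_sum a (u - v) = coord_sum a u - coord_sum a v.
  by rewrite addrC -scaleN1r coord_sum_linear mulN1r addrC.
have := H _ _ _; rewrite N0 !coord_sum_in !linear0 subr0; apply.
- by rewrite -[0](subrr 0) N0 subrr.
- by move=> c u v u0 v0; rewrite coord_sum_linear u0 v0 mulr0 addr0.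
- move=> q r qr y; rewrite N0 !coord_sum_in -ph_natE int_coef_map ?subrr//.
    by apply: Ba; exact: set_valP.
  by apply: Ba; exact: set_valP.
Qed.

(** A basis of the image is given by the classes of the generators of the summands in [B]:
    [coord_sum] gives independence, [component_eq0] removes the other components, and
    [one_compatible] lifts the generators to the limit. *)
Lemma rk_restrict : rk R = #|` fset_set B|.
Proof.
have [[p0 Ip0] _ Iconn] := intervalP I.
pose p : set_type (carrier I) := SigSub (mem_set Ip0).
apply: (rkE (p := p)) => //.
pose e := in_tuple (enum_fset (fset_set B)).
have eB i : B (tnth e i).
  by have := mem_tnth i e; rewrite in_fset_set// inE.
pose x a : R p := bi_in D a (val p) (int_one k (f a) (val p)).
exists (fun i => colim_in (x (tnth e i))); split=> [c c0 i|].
  pose y := \sum_i c i *: x (tnth e i).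
  have /(coord_sum_colim (eB i)) : colim_in y = 0.
    rewrite -[RHS]c0 linear_sum; apply: eq_bigr => j _; exact: linearZ.
  rewrite /y /x !linear_sum (bigD1 i)//= big1 ?addr0 => [|j ji].
    by rewrite !linearZ /= (bi_prK D) int_coef_one ?mulr1//; exact: eB.
  rewrite linearZ /= (bi_pr0 D) ?scaler0 ?linear0// (tnth_nth (tnth e i)).
  by rewrite [X in _ != X](tnth_nth (tnth e i)) nth_uniq ?fset_uniq// eq_sym.
apply/seteqP; split=> [_ [s _ <-]|_ [c ->]].
  exists (fun i => int_coef (bi_pr D (tnth e i) (val p) (lim_proj p s))).
  rewrite /canonical_map.
  pose g a : R p := bi_in D a (val p) (bi_pr D a (val p) (lim_proj p s)).
  have fin := bi_fin D (lim_proj p s : M (val p)).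
  rewrite [in LHS](bi_sum D (lim_proj p s : M (val p))).
  rewrite (@raddf_fsum _ _ (@colim_in _ _ _ R p) _ _ g fin) => [|a]; last first.
    by rewrite /g => /negP/negPn/eqP ->; rewrite linear0.
  rewrite (fsum_fset Bfin) => [|a]; last exact: component_eq0.
  rewrite big_tnth; apply: eq_bigr => i _ /=.
  by rewrite /g [in LHS](int_coefK (bi_pr D (tnth e i) (val p) _)) !linearZ.
exists (\sum_i c i *: (PmLim (one_compatible (eB i)))) => //.
rewrite /canonical_map !linear_sum; apply: eq_bigr => i _.
by rewrite !linearZ.
Qed.

End IntervalRank.

End Rank.

(** * Moebius inversion on posets with finite lower sets *)

Section LowerFinite.
Context (d : Order.disp_t) (T : porderType d).

(** Under reverse containment a lower set consists of the intervals containing a given one. Its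
    finiteness yields local finiteness, convolvability and well-founded recursion. *)
Definition lower_finite : Prop :=
  forall y : T, finite_set [set x | (x <= y)%O].

Hypothesis lfT : lower_finite.

(** The size of the lower set drops strictly along [<], since [y] belongs to its own lower set but
    not to that of a smaller [x]. *)
Lemma lower_finite_wf : well_founded (fun x y : T => (x < y)%O).
Proof.
suff acc n : forall y, (#|` fset_set [set x | (x <= y)%O]| < n)%N ->
    Acc (fun x y : T => (x < y)%O) y by move=> y; exact: (acc _.+1 y (ltnSn _)).
elim: n => [|n IHn] y; first by rewrite ltn0.
move=> yn; constructor=> x xy; apply: IHn.
rewrite -ltnS; apply: leq_trans yn; rewrite ltnS fproper_ltn_card//.
rewrite fproperEneq; apply/andP; split; last first.
  rewrite -fset_set_sub; [|exact: lfT..].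
  by move=> z /= /le_trans; apply; exact: ltW.
apply/eqP => /(fset_set_inj (lfT _) (lfT _))/seteqP[_] /(_ y (lexx y)) /=.
by move=> /le_lt_trans/(_ xy); rewrite ltxx.
Qed.

Lemma lower_finite_locally_finite : locally_finite T.
Proof.
by move=> x y; apply: sub_finite_set (lfT y) => z /= /andP[].
Qed.

Lemma fsum_lower (V : nmodType) (h : T -> V) y :
  \sum_(x \in [set x | (x <= y)%O]) h x =
  h y + \sum_(x \in [set x | (x < y)%O]) h x.
Proof.
rewrite (fsbigD1 y)//=; congr (_ + _); apply: eq_fsbigl.
apply/seteqP; split=> x /=; rewrite lt_neqAle.
  by move=> [-> /eqP ->].
by move=> /andP[/eqP xy ->].
Qed.

(** Injectivity of the zeta transform: by induction the strictly lower terms agree and cancel. *)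
Lemma fsum_lower_inj (V : zmodType) (h h' : T -> V) :
  (forall y, \sum_(x \in [set x | (x <= y)%O]) h x =
             \sum_(x \in [set x | (x <= y)%O]) h' x) -> h =1 h'.
Proof.
move=> hh' y; elim/(well_founded_ind lower_finite_wf): y => y IHy.
have := hh' y; rewrite !fsum_lower.
rewrite (_ : \sum_(x \in [set x | (x < y)%O]) h x =
  \sum_(x \in [set x | (x < y)%O]) h' x); first exact: addIr.
by apply: eq_fsbigr => x; rewrite inE; exact: IHy.
Qed.

Lemma moebius_exists : exists mu : T -> T -> int, is_moebius mu.
Proof.
(* The defining identity is solved for its last term. [pselect] supplies the proof of [z < y] needed
   by the recursive call; its default 0 never occurs in the range of the sum. *)
pose step (x y : T) (rec : forall z, (z < y)%O -> int) : int :=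
  if (x <= y)%O then (x == y)%:R - \sum_(z \in [set z | (x <= z < y)%O])
    (if pselect (z < y)%O is left zy then rec z zy else 0) else 0.
pose mu (x y : T) := Fix lower_finite_wf (fun=> int) (step x) y.
have muE x y : mu x y = if (x <= y)%O then
    (x == y)%:R - \sum_(z \in [set z | (x <= z < y)%O]) mu x z else 0.
  rewrite /mu Fix_eq => [|z g g' gg']; last first.
    congr step; apply: functional_extensionality_dep => t.
    exact: functional_extensionality_dep.
  rewrite /step; case: ifP => // _; congr (_ - _).
  apply: eq_fsbigr => z; rewrite inE /= => /andP[_ zy].
  by case: pselect.
exists mu; split=> x y; first by rewrite muE => /negPf ->.
have [xy|nxy] := boolP (x <= y)%O; last first.
  rewrite (_ : [set z | _] = set0).
    rewrite fsbig_set0; case: eqVneq => // xy.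
    by rewrite xy lexx in nxy.
  apply/seteqP; split=> // z /= /andP[xz zy].
  by rewrite (le_trans xz zy) in nxy.
rewrite (fsbigD1 y) /=; last 2 first.
- exact: lower_finite_locally_finite.
- by rewrite xy lexx.
rewrite muE xy -addrA [X in _ + X](_ : _ = 0) ?addr0//.
apply/eqP; rewrite addrC subr_eq0; apply/eqP/eq_fsbigl.
apply/seteqP; split=> z /=; rewrite lt_neqAle.
  by move=> [/andP[-> ->] /eqP ->].
by move=> /and3P[-> /eqP zy ->].
Qed.

Lemma moebiusP : is_moebius (moebius (T := T)).
Proof.
rewrite /moebius; case: xgetP => [mu ->//|no].
by have [mu /no] := moebius_exists.
Qed.

(** By injectivity of the zeta transform it suffices to sum both sides over a lower set; there the
    exchanged sum collapses through the defining identity of [moebius]. *)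
Lemma moebius_inversionE (g m : T -> int) :
  (forall y, g y = \sum_(x \in [set x | (x <= y)%O]) m x) ->
  moebius_inversion g =1 m.
Proof.
have [mu0 mu1] := moebiusP.
move=> gE; apply: fsum_lower_inj => w; rewrite -gE.
set L := [set x | (x <= w)%O].
(* As [moebius x y] vanishes unless [x <= y], the inner range can be enlarged to [L], which makes
   the two ranges independent. *)
transitivity (\sum_(y \in L) \sum_(x \in L) g x * moebius x y).
  apply: eq_fsbigr => y; rewrite inE /L /= => yw.
  apply: fsbig_widen => [x /= xy|x [_ /= /negP xy]]; first exact: le_trans yw.
  by rewrite /= mu0 ?mulr0.
rewrite exchange_fsbig; [|exact: lfT..].
under eq_fsbigr => x _ do rewrite -mulr_fsumr.
transitivity (\sum_(x \in L) g x * (x == w)%:R).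
  apply: eq_fsbigr => x _; rewrite -mu1; congr (_ * _).
  apply/esym/fsbig_widen => [z /= /andP[]//|z [/= zw] /negP].
  by rewrite zw andbT => xz; rewrite /= mu0.
rewrite (fsbigD1 w) /=; last 2 first.
- exact: lfT.
- exact: lexx.
rewrite eqxx mulr1 fsbig1 ?addr0// => x [_ /eqP/negPf ->].
exact: mulr0.
Qed.

Lemma card_fset_setE (A : choiceType) (F : set A) : finite_set F ->
  Posz #|` fset_set F| = \sum_(a \in F) (1 : int).
Proof.
move=> Ffin; rewrite fsbig_finite// big_const_seq count_predT iter_addr_0.
by rewrite natz.
Qed.

(** Double counting with the indicator of [f a == x]. *)
Lemma card_lower_fibers (A : choiceType) (f : A -> T) y :
  finite_set [set a | (f a <= y)%O] ->
  Posz #|` fset_set [set a | (f a <= y)%O]| =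
  \sum_(x \in [set x | (x <= y)%O]) Posz #|` fset_set [set a | f a = x]|.
Proof.
move=> Ffin; rewrite card_fset_setE//.
transitivity (\sum_(a \in [set a | (f a <= y)%O])
    \sum_(x \in [set x | (x <= y)%O]) ((f a == x)%:R : int)).
  apply: eq_fsbigr => a; rewrite inE /= => ay.
  rewrite (fsbigD1 (f a)) /= ?eqxx ?fsbig1 ?addr0//.
  by move=> x [_ /eqP]; rewrite eq_sym => /negPf ->.
rewrite exchange_fsbig//; apply: eq_fsbigr => x; rewrite inE /= => xy.
rewrite card_fset_setE; last by apply: sub_finite_set Ffin => a /= ->.
transitivity (\sum_(a \in [set a | f a = x]) ((f a == x)%:R : int)).
  apply/esym/fsbig_widen => [a /= -> //|a [_ /= /eqP/negPf]].
  by rewrite /= => ->.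
by apply: eq_fsbigr => a; rewrite inE /= => ->; rewrite eqxx.
Qed.

End LowerFinite.

(** Turns equal multiplicities into a bijection of index sets: [r c] and [s c] list the fibers over
    [c], and an element is matched with the one of the same position in the corresponding fiber. *)
Lemma uniq_seq_bijection (A B C : choiceType) (f : A -> C) (g : B -> C)
    (r : C -> seq A) (s : C -> seq B) :
  (forall c, uniq (r c)) -> (forall c, uniq (s c)) ->
  (forall a c, (a \in r c) = (f a == c)) ->
  (forall b c, (b \in s c) = (g b == c)) ->
  (forall c, size (r c) = size (s c)) ->
  exists2 t : A -> B, bijective t & forall a, g (t a) = f a.
Proof.
move=> ur us rP sP rs.
pose rank a := index a (r (f a)); pose rank' b := index b (s (g b)).
(* Stated for arbitrary labelled types so as to produce both the map and its inverse. *)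
have find (X Y : choiceType) (h : X -> C) (l : C -> seq X) (h' : Y -> C)
    (l' : C -> seq Y) :
    (forall c, uniq (l' c)) -> (forall x c, (x \in l c) = (h x == c)) ->
    (forall y c, (y \in l' c) = (h' y == c)) ->
    (forall c, size (l c) = size (l' c)) ->
    forall x, exists y, h' y = h x /\ index y (l' (h' y)) = index x (l (h x)).
  move=> ul' lP l'P ll' x; set i := index x _.
  have il : (i < size (l' (h x)))%N by rewrite -ll' index_mem lP.
  case E : (l' (h x)) il => [//|y0 l0]; rewrite -E => il.
  have /eqP hy : h' (nth y0 (l' (h x)) i) == h x by rewrite -l'P mem_nth.
  by exists (nth y0 (l' (h x)) i); rewrite hy index_uniq.
have [t tP] := choice (find _ _ f r g s us rP sP rs).
have [t' t'P] := choice (find _ _ g s f r ur sP rP (fun c => esym (rs c))).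
have inj (X : choiceType) (h : X -> C) (l : C -> seq X) x y :
    (forall x c, (x \in l c) = (h x == c)) -> h x = h y ->
    index x (l (h x)) = index y (l (h y)) -> x = y.
  move=> lP xy; rewrite xy => ixy.
  by rewrite -(@nth_index _ x x (l (h y))) ?ixy ?nth_index ?lP ?xy.
exists t; last by move=> a; have [] := tP a.
exists t' => [a|b].
  apply: (inj _ f r) => //; first by have [-> _] := t'P (t a); have [] := tP a.
  by have [_ ->] := t'P (t a); have [] := tP a.
apply: (inj _ g s) => //; first by have [-> _] := tP (t' b); have [] := t'P b.
by have [_ ->] := tP (t' b); have [] := t'P b.
Qed.

(** * Completeness of the generalized rank invariant and recovery of the barcode *)

Section IntervalDecompositions.
Context (k : fieldType) (d : Order.disp_t) (P : porderType d).
Implicit Types (I J : poset_interval P) (M X Y : pmod k P).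

(** At a point of one interval outside the other, the generator would factor through a zero
    space. *)
Lemma interval_mod_inj I J :
  isomorphic (interval_mod k I) (interval_mod k J) -> I = J.
Proof.
have sub I' J' : isomorphic (interval_mod k I') (interval_mod k J') ->
    carrier I' `<=` carrier J'.
  move=> /isomorphicP[f [g [fK _]]] p I'p; apply: contrapT => nJ'p.
  have := fK p (int_one k I' p); rewrite (interval_mod_eq0 (f p _) nJ'p) linear0.
  move=> /esym/(congr1 (@int_coef _ _ _ _ _)); rewrite int_coef_one// linear0.
  by move/eqP; rewrite oner_eq0.
move=> IJ; apply/val_inj/seteqP; split; apply: sub => //.
exact: isomorphic_sym.
Qed.

Lemma decomposable_biproduct (S : set (poset_interval P)) M :
  decomposable_over S M -> exists (A : choiceType) (f : A -> poset_interval P),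
    (forall a, S (f a)) /\ inhabited (biproduct M (fun a => interval_mod k (f a))).
Proof.
move=> [D DS]; have [B _] := direct_sum_biproduct (@summand_sum _ _ _ _ D).
have {}DS a : exists I, S I /\ isomorphic (D a) (interval_mod k I).
  by have [I] := DS a; exists I.
have [f fP] := choice DS; exists (dec_index D), f; split=> [a|].
  by have [] := fP a.
by apply: biproduct_isomorphic_summands B => a; have [] := fP a.
Qed.

Section Counting.
Variables (M : pmod k P) (A : choiceType) (f : A -> poset_interval P).
Variable D : biproduct M (fun a => interval_mod k (f a)).

Lemma finite_fiber I : finite_set [set a | f a = I].
Proof. by apply: sub_finite_set (finite_intervals_above D I) => a /= ->. Qed.

(** Grouping the summands counted by the rank according to their interval gives the zeta transform
    of the multiplicity function. *)
Lemma rk_restrict_fibers (S : set (poset_interval P)) (y : set_type S) :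
  lower_finite (set_type S) -> (forall a, S (f a)) ->
  Posz (rk (Defs.restrict M (val y))) =
  \sum_(x \in [set x | (x <= y)%O]) Posz #|` fset_set [set a | f a = val x]|.
Proof.
move=> Sfin fS; rewrite (rk_restrict D).
pose f' a : set_type S := SigSub (mem_set (fS a)).
have f'E : [set a | carrier (val y) `<=` carrier (f a)] = [set a | (f' a <= y)%O].
  by apply/seteqP; split=> a /asboolP.
have f'fib x : [set a | f a = val x] = [set a | f' a = x].
  apply/seteqP; split=> a /= => [fa|<- //].
  exact: val_inj.
under eq_fsbigr do rewrite f'fib.
have := finite_intervals_above D (val y).
by rewrite f'E => /(card_lower_fibers Sfin).
Qed.

(** The comparison of multiplicities applies in both directions, interval modules being
    indecomposable, and [interval_mod_inj] identifies the fiber of [f] with the summands isomorphic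
    to the interval module. *)
Lemma card_summands (D' : decomposition M) I :
  [set a | isomorphic (D' a) (interval_mod k I)]
  #= `I_#|` fset_set [set a | f a = I]|.
Proof.
have [B _] := direct_sum_biproduct (@summand_sum _ _ _ _ D').
have fibE : [set a | f a = I] =
    [set a | isomorphic (interval_mod k (f a)) (interval_mod k I)].
  apply/seteqP; split=> a /= => [->|/interval_mod_inj//].
  exact: isomorphic_refl.
have /finite_setP[n Bn] := finite_isomorphic_summands I B.
rewrite fibE (_ : #|` _| = n)// -(card_fset_set Bn); apply/eqP; rewrite eqn_leq.
rewrite (card_isomorphic_summands_le I D B (@summand_indec _ _ _ _ D')).
apply: (card_isomorphic_summands_le I B D) => a.
exact: interval_mod_indecomposable.
Qed.

End Counting.

Lemma lower_finite_intervals (S : set (poset_interval P)) :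
  (forall I, finite_set [set J | S J /\ carrier I `<=` carrier J]) ->
  lower_finite (set_type S).
Proof.
move=> Sfin y; apply: sub_finite_set (finite_preimage _ (Sfin (val y))).
  by move=> x /asboolP xy; split; [exact: set_valP|exact: xy].
by move=> u v _ _; exact: val_inj.
Qed.

Lemma gri_isomorphic (S : set (poset_interval P)) M N :
  decomposable_over S M -> decomposable_over S N ->
  gri (S := S) M = gri (S := S) N -> isomorphic M N.
Proof.
move=> /decomposable_biproduct[A [f [fS [D]]]].
move=> /decomposable_biproduct[B [g [gS [E]]]] MN.
(* Lower sets in [S] can be infinite. Those in the set of intervals occurring in [M] or [N] are
   finite, so the zeta transform is injective there; outside it both multiplicities are 0. *)
pose S' := range f `|` range g.
have fS' a : S' (f a) by left; exists a.
have gS' b : S' (g b) by right; exists b.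
have S'S I : S' I -> S I by move=> [] [a _ <-].
have S'fin : lower_finite (set_type S').
  apply: lower_finite_intervals => I.
  apply: (@sub_finite_set _ _ (f @` [set a | carrier I `<=` carrier (f a)] `|`
    g @` [set b | carrier I `<=` carrier (g b)])).
    by move=> _ [[[a _ <-]|[b _ <-]]] IJ; [left; exists a|right; exists b].
  rewrite finite_setU; split; apply: finite_image.
    exact: finite_intervals_above D _.
  exact: finite_intervals_above E _.
have fibers I :
    #|` fset_set [set a | f a = I]| = #|` fset_set [set b | g b = I]|.
  have [S'I|nS'I] := pselect (S' I); last first.
    rewrite (_ : [set a | f a = I] = set0); last first.
      by apply/seteqP; split=> // a /= fa; apply: nS'I; rewrite -fa.
    rewrite (_ : [set b | g b = I] = set0) ?fset_set0//.
    by apply/seteqP; split=> // b /= gb; apply: nS'I; rewrite -gb.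
  pose x : set_type S' := SigSub (mem_set S'I).
  suff /(_ x)[] : (fun x : set_type S' =>
      Posz #|` fset_set [set a | f a = val x]|) =1
    (fun x => Posz #|` fset_set [set b | g b = val x]|) by [].
  apply: fsum_lower_inj => // y.
  rewrite -(rk_restrict_fibers D)// -(rk_restrict_fibers E)//; congr Posz.
  have Sy : S (val y) by apply: S'S; exact: set_valP.
  exact: (congr1 (fun r => r (SigSub (mem_set Sy) : set_type S)) MN).
have [||a I|b I|//|t tbij gt] := @uniq_seq_bijection A B _ f g
  (fun I => fset_set [set a | f a = I]) (fun I => fset_set [set b | g b = I]).
- by move=> I; exact: fset_uniq.
- by move=> I; exact: fset_uniq.
- rewrite in_fset_set; last exact: finite_fiber D _.
  by apply/idP/eqP; rewrite inE.
- rewrite in_fset_set; last exact: finite_fiber E _.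
  by apply/idP/eqP; rewrite inE.
have [E'] := biproduct_reindex tbij E.
apply: (biproduct_isomorphic D).
by rewrite (_ : (fun a => _) = fun a => interval_mod k (g (t a)))//;
  apply: funext => a; rewrite gt.
Qed.

Lemma moebius_inversion_barc M : interval_decomposable M ->
  let S := barc_intervals M in
  let g := fun I : set_type S => Posz (gri M I) in
  [/\ locally_finite (set_type S),
      convolvable g
    & forall I : set_type S, exists2 n : nat,
        barc_mult (interval_mod k (val I)) M n
        & moebius_inversion g I = Posz n].
Proof.
move=> [A [f [inj /direct_sum_biproduct[D _]]]] S g.
pose dec := Decomposition (biproduct_direct_sum D)
  (fun a => interval_mod_indecomposable k (f a)).
have fS a : S (f a).
  suff : [set b | isomorphic (dec b) (interval_mod k (f a))] a by exists dec, a.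
  exact: isomorphic_refl.
(* Membership in [S] refers to some decomposition [D']; [card_summands] transfers it to the given
   one, as an empty fiber of [f] would leave no such summand in [D']. *)
have Sf I : S I -> exists a, f a = I.
  move=> [D' [b bI]]; apply: contrapT => nf.
  have := card_summands D D' I; rewrite (_ : [set a | f a = I] = set0).
    rewrite fset_set0 cardfs0 II0 card_eq0 => /eqP/seteqP[/(_ b)+ _].
    exact.
  by apply/seteqP; split=> // a fa; apply: nf; exists a.
have Sfin : lower_finite (set_type S).
  apply: lower_finite_intervals => I.
  apply: sub_finite_set (finite_image f (finite_intervals_above D I)).
  by move=> _ [/Sf[a <-] IJ]; exists a.
split; first exact: lower_finite_locally_finite.
  by move=> y; apply: sub_finite_set (Sfin y) => x /= [].
move=> I; exists #|` fset_set [set a | f a = val I]|.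
  by split=> [|D']; [exact: (inhabits dec)|exact: card_summands].
rewrite (moebius_inversionE Sfin (m := fun I : set_type S =>
  Posz #|` fset_set [set a | f a = val I]|))// => y.
exact: rk_restrict_fibers.
Qed.

End IntervalDecompositions.

Theorem theorem5 (k : fieldType) (d : Order.disp_t) (P : porderType d) :
  (forall (S : set (poset_interval P)) (M N : pmod k P),
     decomposable_over S M -> decomposable_over S N ->
     gri (S := S) M = gri (S := S) N -> isomorphic M N)
  /\
  (forall M : pmod k P, interval_decomposable M ->
     let S := barc_intervals M in
     let g := fun I : set_type S => Posz (gri M I) in
     [/\ locally_finite (set_type S),
         convolvable g
       & forall I : set_type S, exists2 n : nat,
           barc_mult (interval_mod k (val I)) M n
           & moebius_inversion g I = Posz n]).
Proof.
by split=> [S M N|M]; [exact: gri_isomorphic|exact: moebius_inversion_barc].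
Qed.
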